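(* Let $\rho$ be a coherent risk measure and let $((\Omega,\mathcal F,\mathbb P),\mathcal P)$ be a market. Let $u_R:\mathbb R\to\mathbb R$ be any concave increasing utility function satisfying $$\lim_{\lambda\to\infty}\frac{u_R(-\lambda)}{\lambda}=-\infty.$$ Let $X$ and $Y$ be random variables. If $X$ is a $\rho$-arbitrage and not a true arbitrage, and if both $\mathbb E(|X|)$ and $\mathbb E(u_R(-\beta Y))$ are finite for some $\beta>0$, then $$\lim_{\lambda\to\infty}\mathbb E(u_R(Y+\lambda X))=-\infty.$$
   Context: A market consists of a probability space $(\Omega,\mathcal F,\mathbb P)$ and a function $\mathcal P:L^0(\Omega,\mathbb R)\to\mathbb R\cup\{+\infty\}$ (random variables are asset payoffs, $\mathcal P$ gives their price). A coherent risk measure is a function $\rho:L^0(\Omega;\mathbb R)\to\mathbb R\cup\{\infty\}$, finite on $L^\infty(\Omega;\mathbb R)$, satisfying: (i) $\rho(0)=0$; (ii) $\rho(X)\ge\rho(Y)$ if $X\le Y$ almost surely; (iii) $\rho(X_1+X_2)\le\rho(X_1)+\rho(X_2)$; (iv) $\rho(X+a)=\rho(X)-a$ for $a\in\mathbb R$; (v) $\rho(\lambda X)=\lambda\rho(X)$ for $\lambda\in\mathbb R^+$. A random variable $X$ is a $\rho$-arbitrage if $\mathcal P(X)\le 0$, $\rho(X)\le 0$ and $\mathbb P(X>0)>0$. A random variable $X$ is a true arbitrage if $\mathcal P(X)\le 0$, $X\ge 0$ almost surely and $\mathbb P(X>0)>0$. The expectation $\mathbb E(u_R(Y+\lambda X))$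 is allowed to take the value $-\infty$. *)

(* Defs.v *)
From mathcomp Require Import all_boot all_order all_algebra.
From mathcomp Require Import all_classical all_reals all_analysis.
From mathcomp Require Import measurable_realfun.

Set Implicit Arguments.
Unset Strict Implicit.
Unset Printing Implicit Defensive.

Import Order.TTheory GRing.Theory Num.Theory.
Import numFieldNormedType.Exports.

Local Open Scope classical_set_scope.
Local Open Scope ring_scope.

Section L0.
Context d (T : measurableType d) (R : realType) (P : probability T R).

(* L^0(Omega; R): random variables modulo almost sure equality. *)
Definition L0 : Type := {mfun_ P, T >-> R}.

Definition L0_class (X : {RV P >-> R}) : L0 := (\pi_({mfun_ P, T >-> R}) X)%qT.

End L0.

Arguments L0 {d T R} P.
Arguments L0_class {d T R P} X.

Section risk.
Context d (T : measurableType d) (R : realType) (P : probability T R).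
Implicit Types (X Y : {RV P >-> R}) (rho price : L0 P -> \bar R).

(* Functions into R u {+oo} are \bar R-valued functions omitting -oo. *)
Definition gtNy_valued (f : L0 P -> \bar R) := forall Z, f Z != -oo%E.

Record coherent_risk_measure rho : Prop := CoherentRiskMeasure {
  coherent_gtNy : gtNy_valued rho;
  coherent_Loo : forall X, (X : T -> R) \in Lfun P +oo%E ->
    rho (L0_class X) \is a fin_num;
  coherent0 : rho (L0_class (cst 0)) = 0%E;
  coherent_anti : forall X Y, {ae P, forall w, X w <= Y w} ->
    (rho (L0_class Y) <= rho (L0_class X))%E;
  coherentD : forall X Y,
    (rho (L0_class (X + Y)%R) <= rho (L0_class X) + rho (L0_class Y))%E;
  coherent_cash : forall X (a : R),
    rho (L0_class (X + cst a)%R) = (rho (L0_class X) - a%:E)%E;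
  coherentZ : forall X (l : R), 0 < l ->
    rho (L0_class (l *: X)%R) = (l%:E * rho (L0_class X))%E
}.

Definition rho_arbitrage price rho X : Prop :=
  [/\ (price (L0_class X) <= 0)%E,
      (rho (L0_class X) <= 0)%E &
      (0 < P [set w | (0 < X w)%R])%E].

Definition true_arbitrage price X : Prop :=
  [/\ (price (L0_class X) <= 0)%E,
      {ae P, forall w, 0 <= X w} &
      (0 < P [set w | (0 < X w)%R])%E].

End risk.

Definition concave (R : realType) (u : R -> R) : Prop :=
  convex_function (E := R^o) setT (fun x => - u x).

(* Main.v *)
(* Writing c for the slope u 0 - u (-1), concavity and monotonicity give
   u (Y + l X) <= |u 0| + c (Y^+ + l |X|), where Y^+ is integrable because
   - u (- b Y) dominates b Y for large Y.  As X is not a true arbitrage,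
   X <= - e and Y <= M on some event of probability p > 0, and on it
   u (Y + l X) is at most u (M - l e).  Hence E (u (Y + l X)) is at most p u (M - l e) plus an
   affine function of l, and the first term decreases superlinearly. *)
Require Import Defs.
From mathcomp Require Import all_boot all_order all_algebra.
From mathcomp Require Import all_classical all_reals all_analysis.
From mathcomp Require Import measurable_realfun.
From mathcomp Require Import ring lra.

Import Order.TTheory GRing.Theory Num.Theory.
Import numFieldNormedType.Exports.

Local Open Scope classical_set_scope.
Local Open Scope ring_scope.

(** The point 0 is the convex combination of [-1] and [x] with weights [x / (1 + x)] and
    [1 / (1 + x)]; concavity at 0, solved for [u x], gives the bound. *)
Lemma concave_le_affine (R : realType) (u : R -> R) (x : R) :
  concave u -> 0 <= x -> u x <= u 0 + (u 0 - u (-1)) * x.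
Proof.
move=> cu x0.
have x1 : 0 < 1 + x by lra.
have t0 : 0 <= x / (1 + x) by rewrite divr_ge0// ltW.
have t1 : x / (1 + x) <= 1 by rewrite ler_pdivrMr//; lra.
have := cu (Itv01 t0 t1) (-1) x (mem_set I) (mem_set I).
have -> : conv (Itv01 t0 t1) (-1 : convex_lmodType R^o) x = 0.
  rewrite [LHS]convRE /= /unstable.onem; field; lra.
rewrite [leRHS]convRE /= /unstable.onem => h.
have {}h : - u 0 * (1 + x) <= - (x * u (-1)) - u x.
  rewrite -ler_pdivlMr//; apply: le_trans h _.
  rewrite le_eqVlt; apply/orP; left; apply/eqP; field; lra.
lra.
Qed.

(** Only [g] is integrable, so the integral of [f] may be -oo. The positive and negative parts are
    compared separately, the latter in reverse order. *)
Lemma le_integral_integrable d (T : measurableType d) (R : realType)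
    (mu : measure T R) (f g : T -> \bar R) :
  measurable_fun setT f -> mu.-integrable setT g -> (forall x, f x <= g x)%E ->
  (\int[mu]_x f x <= \int[mu]_x g x)%E.
Proof.
move=> mf /integrableP[mg gi] fg; rewrite integralE [leRHS]integralE leeB//.
- apply: ge0_le_integral => //; [exact: measurable_funepos..|move=> x _].
  by apply: (@funepos_le _ _ setT) => //; rewrite inE.
- apply: ge0_le_integral => //; [exact: measurable_funeneg..|move=> x _].
  by apply: (@funeneg_le _ _ setT) => //; rewrite inE.
Qed.

(** A difference of extended reals is finite only if both terms are, and [|f|] is the sum of the two
    parts of [f]. *)
Lemma integral_fin_num_integrable d (T : measurableType d) (R : realType)
    (mu : measure T R) (f : T -> \bar R) :
  measurable_fun setT f -> (\int[mu]_x f x)%E \is a fin_num ->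
  mu.-integrable setT f.
Proof.
move=> mf; rewrite integralE fin_numB => /andP[fp fn].
apply/integrableP; split => //.
rewrite -[fun x => _]/(abse \o f) fune_abse ge0_integralD//;
  [|exact: measurable_funepos|exact: measurable_funeneg].
by rewrite lte_add_pinfty// ltey_eq ?fp ?fn.
Qed.

Lemma superlinear_funrpos_integrable d (T : measurableType d) (R : realType)
    (P : probability T R) (u : R -> R) (Y : T -> R) (b : R) :
  (u (- l) / l @[l --> +oo] --> -oo) -> 0 < b ->
  measurable_fun setT Y ->
  P.-integrable setT (fun w => (u (- b * Y w))%:E) ->
  P.-integrable setT (EFin \o Y^\+%R).
Proof.
move=> /cvgrNyPle/(_ (-1)) [L [_ uL]] b0 mY ui.
(* [L1] is strictly above [L], so that [uL] applies from [L1] on, and positive, so that its quotient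
   can be cleared. *)
pose L1 := Num.max L 0 + 1.
have LL1 : L < L1 by rewrite ltr_pwDr// le_max lexx.
have L10 : 0 < L1 by rewrite ltr_pwDr// le_max lexx orbT.
have ubL y : L1 <= y -> y <= `|u (- y)|.
  move=> Ly; have y0 : 0 < y by exact: lt_le_trans Ly.
  have /uL : L < y by exact: lt_le_trans Ly.
  by rewrite ler_pdivrMr// => h; rewrite ler_normr; apply/orP; right; lra.
(* This function dominates the positive part of [Y]: where [b * Y] is below [L1] the constant
   suffices, elsewhere [ubL] does. *)
have gi : P.-integrable setT
    (fun w => (b^-1)%:E * (L1%:E + `|(u (- b * Y w))%:E|))%E.
  apply: integrableZl => //; apply: integrableD => //.
  - exact: finite_measure_integrable_cst.
  - exact: integrable_abse ui.
apply: le_integrable gi => //.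
  by apply/measurable_EFinP; exact: measurable_funrpos.
move=> w _; rewrite /= /funrpos ?abse_EFin -?EFinD -?EFinM ?lee_fin.
rewrite ger0_norm ?le_max ?lexx ?orbT// ger0_norm; last first.
  apply: mulr_ge0; first by rewrite invr_ge0 ltW.
  by apply: addr_ge0 => //; exact: ltW.
rewrite mulrC ler_pdivlMr//.
have [Y0|Y0] := leP (Y w) 0; first by rewrite mul0r addr_ge0// ltW.
have [/ubL|] := leP L1 (Y w * b).
  by rewrite [Y w * b]mulrC -mulNr => /le_trans; apply; rewrite lerDr ltW.
by have := normr_ge0 (u (- b * Y w)); lra.
Qed.

Lemma measurable_sublevel d (T : measurableType d) (R : realType)
    (f : T -> R) (a : R) :
  measurable_fun setT f -> measurable [set w | f w <= a].
Proof.
move=> mf; rewrite -[X in measurable X]setTI.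
by have := mf measurableT _ (measurable_itv `]-oo, a]); rewrite set_itvE.
Qed.

(** These events cover [X < 0] as [n] varies; if all were null, so would be their countable
    union. *)
Lemma negative_on_bounded_set d (T : measurableType d) (R : realType)
    (mu : measure T R) (X Y : T -> R) :
  measurable_fun setT X -> measurable_fun setT Y ->
  ~ {ae mu, forall w, 0 <= X w} ->
  exists n, (0 < mu ([set w | (X w <= - n.+1%:R^-1)%R] `&`
                 [set w | (Y w <= n%:R)%R])%classic)%E.
Proof.
move=> mX mY nX; apply/not_existsP => h; apply: nX.
apply: (@negligibleS _ _ _ _ (\bigcup_n
  ([set w | X w <= - n.+1%:R^-1] `&` [set w | Y w <= n%:R]))).
  move=> w /= /negP; rewrite -ltNge => Xw.
  (* A single integer exceeding both [Y w] and [(- X w)^-1] serves for both conditions. *)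
  have /archi_boundP : 0 <= Num.max (Y w) (- X w)^-1.
    by rewrite le_max [X in _ || X]invr_ge0 oppr_ge0 (ltW Xw) orbT.
  set n := Num.bound _; rewrite gt_max => /andP[Yn Xn].
  exists n => //; split => /=; last exact: ltW.
  rewrite lerNr -[leRHS]invrK lef_pV2 ?posrE ?invr_gt0 ?oppr_gt0//.
  by rewrite (le_trans (ltW Xn))// ler_nat.
apply: negligible_bigcup => k; apply/negligibleP; last first.
  by apply/eqP; rewrite -measure_le0 leNgt; apply/negP; exact: h.
by apply: measurableI; exact: measurable_sublevel.
Qed.

(* The library's expectation returns -oo on a function whose positive and
   negative parts both have infinite integral; the first conjunct excludes this,
   so that the expectations in the limit are genuine elements of [-oo, +oo[. *)
Theorem theorem1p7 (R : realType) (d : measure_display) (T : measurableType d)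
  (P : probability T R) (price rho : L0 P -> \bar R) (u : R -> R)
  (X Y : {RV P >-> R}) :
  gtNy_valued price ->
  coherent_risk_measure rho ->
  concave u ->
  {homo u : x y / x <= y} ->
  (u (- l) / l @[l --> +oo] --> -oo) ->
  rho_arbitrage price rho X ->
  ~ true_arbitrage price X ->
  ('E_P[(fun w => `|X w|)%R] \is a fin_num)%E ->
  (exists2 b : R, 0 < b & ('E_P[(fun w => u (- b * Y w))%R] \is a fin_num)%E) ->
  (forall l : R, 0 <= l ->
     ('E_P[((fun w => u (Y w + l * X w))^\+)%R] < +oo)%E) /\
  ('E_P[(fun w => u (Y w + l * X w))%R]%E @[l --> +oo%R] --> -oo%E).
Proof.
move=> _ _ cu uh ul [priceX _ X_gt0] nta EX [b b0 Eu].
have um : measurable_fun setT u by exact: nondecreasing_measurable.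
have mX : measurable_fun setT X by [].
have mY : measurable_fun setT Y by [].
have iX : P.-integrable setT (fun w => `|X w|%:E).
  apply: integral_fin_num_integrable; last by rewrite unlock in EX.
  by apply/measurable_EFinP; exact: measurableT_comp.
have iY : P.-integrable setT (EFin \o Y^\+%R).
  apply: (superlinear_funrpos_integrable _ _ _ _ _ _ _ ul b0) => //.
  apply: integral_fin_num_integrable; last by rewrite unlock in Eu.
  by apply/measurable_EFinP/(measurableT_comp um); exact: measurable_funM.
have mf (l : R) : measurable_fun setT (fun w => u (Y w + l * X w)).
  apply: (measurableT_comp um); apply: measurable_funD => //.
  exact: measurable_funM.
pose c := u 0 - u (-1).
have c0 : 0 <= c by rewrite subr_ge0 uh// lerN10.
(* An integrable majorant of [u (Y + l X)]. Taking [|u 0|] instead of [u 0] makes it nonnegative, so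
   it also dominates the positive part. *)
pose h (l : R) w : R := `|u 0| + c * (Y^\+%R w + l * `|X w|).
have h_ge0 (l : R) w : 0 <= l -> 0 <= h l w.
  move=> l0; apply: addr_ge0 => //; apply: mulr_ge0 => //.
  by apply: addr_ge0; [exact: funrpos_ge0|exact: mulr_ge0].
have fh (l : R) w : 0 <= l -> u (Y w + l * X w) <= h l w.
  move=> l0; have YX0 : 0 <= Y^\+%R w + l * `|X w|.
    by apply: addr_ge0; [exact: funrpos_ge0|exact: mulr_ge0].
  have /uh/le_trans : Y w + l * X w <= Y^\+%R w + l * `|X w|.
    by rewrite lerD// ?ler_wpM2l ?ler_norm// /funrpos le_max lexx.
  apply; rewrite (le_trans (concave_le_affine _ _ _ cu YX0))//.
  by rewrite lerD2r ler_norm.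
have ih (l : R) : P.-integrable setT (EFin \o h l).
  rewrite (_ : _ \o _ = fun w =>
      ((`|u 0|)%:E + c%:E * ((EFin \o Y^\+%R) w + l%:E * `|X w|%:E))%E)//.
  apply: integrableD => //; first exact: finite_measure_integrable_cst.
  apply: integrableZl => //; apply: integrableD => //; exact: integrableZl.
pose D := fine (\int[P]_w `|X w|%:E)%E.
pose B := fine (\int[P]_w (Y^\+%R w)%:E)%E.
have EabsX : (\int[P]_w `|X w|%:E)%E = D%:E.
  by rewrite /D fineK//; exact: integrable_fin_num.
have EYpos : (\int[P]_w (Y^\+%R w)%:E)%E = B%:E.
  by rewrite /B fineK//; exact: integrable_fin_num.
have Eh (l : R) : (\int[P]_w (h l w)%:E = (`|u 0| + c * (B + l * D))%:E)%E.
  rewrite (_ : (fun w => (h l w)%:E) = fun w =>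
      ((`|u 0|)%:E + c%:E * ((EFin \o Y^\+%R) w + l%:E * `|X w|%:E))%E)//.
  rewrite integralD//=; [|exact: finite_measure_integrable_cst|].
    rewrite integral_cst// [X in (_ * X)%E](@probability_setT _ _ _ P) mule1.
    rewrite integralZl//; last first.
      by apply: integrableD => //; exact: integrableZl.
    rewrite integralD//; last exact: integrableZl.
    rewrite integralZl//.
    by rewrite EabsX EYpos.
  by apply: integrableZl => //; apply: integrableD => //; exact: integrableZl.
split=> [l l0|].
  rewrite unlock; apply: (@le_lt_trans _ _ (\int[P]_w (h l w)%:E)%E);
    last by rewrite Eh ltry.
  apply: le_integral_integrable (ih l) _.
    by apply/measurable_EFinP; exact: measurable_funrpos.
  by move=> w; rewrite lee_fin /funrpos ge_max fh// h_ge0.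
(* The other two conditions of a true arbitrage already hold for the rho-arbitrage [X]. *)
have nX : ~ {ae P, forall w, 0 <= X w}.
  by move=> X0; apply: nta; split.
have [n] := negative_on_bounded_set _ _ _ _ _ _ mX mY nX.
pose A := [set w | X w <= - n.+1%:R^-1] `&` [set w | Y w <= n%:R].
rewrite -/A => A_gt0.
have mA : measurable A.
  by apply: measurableI; exact: measurable_sublevel.
pose p := fine (P A).
have PA : P A = p%:E by rewrite fineK// fin_num_measure.
have p0 : 0 < p by rewrite -lte_fin -PA.
pose e : R := n.+1%:R^-1.
have e0 : 0 < e by rewrite invr_gt0.
(* On [A] the utility is at most [u (n - l e)]. Since [h] is nonnegative it can be kept on [A] too,
   and its integral [Eh] is reused whole. *)
pose g (l : R) w : R := u (n%:R - l * e) * \1_A w + h l w.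
have fg (l : R) w : 0 <= l -> u (Y w + l * X w) <= g l w.
  move=> l0; rewrite /g indicE; have [|_] := boolP (w \in A); last first.
    by rewrite mulr0 add0r fh.
  rewrite inE => -[/= Xw Yw]; rewrite mulr1.
  rewrite (le_trans (uh _ (n%:R - l * e) _))//.
    by rewrite lerD// -mulrN ler_wpM2l.
  by rewrite lerDl h_ge0.
have ig0 (l : R) : P.-integrable setT
    (fun w => (u (n%:R - l * e))%:E * (\1_A w)%:E)%E.
  by apply: integrableZl => //; exact: integrable_indic.
have ig (l : R) : P.-integrable setT (EFin \o g l).
  by apply: (integrableD _ (ig0 l) (ih l)).
have Eg l : (\int[P]_w (g l w)%:E =
    (u (n%:R - l * e) * p + (`|u 0| + c * (B + l * D)))%:E)%E.
  rewrite (_ : (fun w => (g l w)%:E) = fun w =>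
      ((u (n%:R - l * e))%:E * (\1_A w)%:E + (EFin \o h l) w)%E)//.
  rewrite integralD// [X in (_ + X)%E]Eh.
  rewrite integralZl//; last exact: integrable_indic.
  by rewrite integral_indic// setIT [X in (_ * X + _)%E]PA.
(* The slope - K makes the bound on E (u (Y + l X)) equal to - l + constant. *)
pose K := (c * D + 1) / (p * e).
have KE : K * (p * e) = c * D + 1 by rewrite divfK// mulf_neq0// gt_eqF.
apply/cvgeNyPle => N.
move/cvgrNyPle : ul => /(_ (- K))[L [_ uL]].
near=> l.
have l0 : 0 <= l by near: l; apply: nbhs_pinfty_ge; exact: num_real.
(* The guaranteed loss on [A]: once [m] exceeds [L], the superlinear decay bounds [u (- m)] by
   [- K * m]. *)
pose m := l * e - n%:R.
have lm (a : R) : (a + n%:R) / e < l -> a < m.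
  by rewrite ltr_pdivrMr// -ltrBrDr.
have m0 : 0 < m by apply: lm; near: l; apply: nbhs_pinfty_gt; exact: num_real.
have unm : u (n%:R - l * e) <= - K * m.
  rewrite -(opprB (l * e)) -ler_pdivrMr//; apply: uL; apply: lm.
  by near: l; apply: nbhs_pinfty_gt; exact: num_real.
rewrite unlock (@le_trans _ _ (\int[P]_w (g l w)%:E)%E)//.
  apply: le_integral_integrable (ig l) _; first exact/measurable_EFinP.
  by move=> w; rewrite lee_fin fg.
rewrite Eg lee_fin.
(* The left side is the constant remaining after [c * l * D] cancels, minus the target [N]. *)
have Nl : K * p * n%:R + `|u 0| + c * B - N <= l.
  by near: l; apply: nbhs_pinfty_ge; exact: num_real.
have : u (n%:R - l * e) * p <= - K * m * p by rewrite ler_wpM2r// ltW.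
have -> : - K * m * p = - l * (K * (p * e)) + K * p * n%:R by rewrite /m; ring.
rewrite KE; move: Nl; nra.
Unshelve. all: by end_near.
Qed.
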